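(* Let $p\geq 2$ and let $G$ be a $K_{1,p+1}$-free $2p$-regular graph. Let $\vec{G}$ be an orientation of $G$ that admits an out-neighbourhood bijective homomorphism $\psi$ to $\vec{L}(K_{p+2})$. Then $\psi$ is a locally bijective homomorphism from $\vec{G}$ to $\vec{L}(K_{p+2})$. In particular, $\psi$ is a locally bijective homomorphism from $G$ to $L^*(K_{p+2})$.
   Context: $K_{1,p+1}$-free means no induced subgraph isomorphic to $K_{1,p+1}$. $\vec{L}(K_{p+2})$ is the oriented graph whose vertices are the ordered pairs $(i,j)$ of distinct elements of $\mathbb{Z}_{p+2}$, with an arc from $(i,j)$ to $(j,k)$ whenever $k\neq i$; $L^*(K_{p+2})$ is its underlying undirected graph. An out-neighbourhood bijective homomorphism from $\vec{G}$ to $\vec{H}$ is a map $\psi$ such that for every $v$ the restriction of $\psi$ to $N^+_{\vec{G}}(v)$ is a bijection onto $N^+_{\vec{H}}(\psi(v))$. A locally bijective homomorphism between oriented graphs is a map that, for every vertex $v$, maps the in-neighbours of $v$ bijectively onto the in-neighbours of $\psi(v)$ and the out-neighbours of $v$ bijectively onto the out-neighbours of $\psi(v)$. A locally bijective homomorphism between undirected graphs $G\to H$ is a map whose restriction to each $N_G(v)$ is a bijection onto $N_H(\psi(v))$. *)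

(* Defs.v *)
From mathcomp Require Import all_boot zmodp.

Set Implicit Arguments.
Unset Strict Implicit.
Unset Printing Implicit Defensive.

Definition simple_graph (T : finType) (e : rel T) : Prop :=
  symmetric e /\ irreflexive e.

(* No loops and no two opposite arcs: a loop is its own opposite. *)
Definition oriented_graph (T : finType) (a : rel T) : Prop :=
  forall x y : T, a x y -> ~~ a y x.

Definition underlying (T : finType) (a : rel T) : rel T :=
  [rel x y | a x y || a y x].

Definition orientation_of (T : finType) (e a : rel T) : Prop :=
  oriented_graph a /\ underlying a =2 e.

(* On a symmetric relation, [out_nbr] is the neighbourhood of a vertex. *)
Definition out_nbr (T : finType) (a : rel T) (v : T) : {set T} :=
  [set w | a v w].

Definition in_nbr (T : finType) (a : rel T) (v : T) : {set T} :=
  [set w | a w v].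

Definition regular (T : finType) (k : nat) (e : rel T) : Prop :=
  forall v : T, #|out_nbr e v| = k.

Definition induced (T : finType) (e : rel T) (S : {set T}) :
  rel {x : T | x \in S} := [rel x y | e (val x) (val y)].

Definition isomorphic (T U : finType) (e : rel T) (f : rel U) : Prop :=
  exists2 phi : T -> U,
    bijective phi & forall x y : T, f (phi x) (phi y) = e x y.

Definition induced_free (U T : finType) (h : rel U) (e : rel T) : Prop :=
  forall S : {set T}, ~ isomorphic (induced e (S := S)) h.

(* Complete bipartite graph, with the two summands as its parts. *)
Definition biclique (m n : nat) : rel ('I_m + 'I_n)%type :=
  [rel x y | is_inl x != is_inl y].

Definition maps_bij (T U : finType) (f : T -> U) (A : {set T}) (B : {set U}) :
  Prop := {in A &, injective f} /\ f @: A = B.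

Definition out_nbr_bij_hom (T U : finType) (a : rel T) (b : rel U)
  (psi : T -> U) : Prop :=
  forall v : T, maps_bij psi (out_nbr a v) (out_nbr b (psi v)).

Definition loc_bij_hom_oriented (T U : finType) (a : rel T) (b : rel U)
  (psi : T -> U) : Prop :=
  forall v : T,
    maps_bij psi (in_nbr a v) (in_nbr b (psi v)) /\
    maps_bij psi (out_nbr a v) (out_nbr b (psi v)).

Definition loc_bij_hom (T U : finType) (e : rel T) (f : rel U)
  (psi : T -> U) : Prop :=
  forall v : T, maps_bij psi (out_nbr e v) (out_nbr f (psi v)).

Definition Lvertex (p : nat) : finType :=
  {ij : 'Z_p.+2 * 'Z_p.+2 | ij.1 != ij.2}.

Definition Larc (p : nat) : rel (Lvertex p) :=
  [rel u v | ((val u).2 == (val v).1) && ((val v).2 != (val u).1)].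

Definition Lstar (p : nat) : rel (Lvertex p) := underlying (@Larc p).

(* Main.v *)
Require Import Defs.
From mathcomp Require Import all_boot zmodp.

Set Implicit Arguments.
Unset Strict Implicit.
Unset Printing Implicit Defensive.

(* Every vertex v has p out-neighbours and p in-neighbours, and both sets are
   independent because their images in L(K_(p+2)) are.  An out-neighbour over
   (j,k) can only be adjacent to an in-neighbour over (k,i), where psi v = (i,j);
   so if (k,i) is missed by psi on the in-neighbours, adding the out-neighbour
   over (j,k) to the in-neighbours gives an induced K_(1,p+1).  Hence psi is onto
   on in-neighbours, and bijective by counting. *)

(** If [A] had [m.+1] elements, [v |: A] would induce a star with centre [v] and leaves [A]. *)
Lemma star_free_card_independent (T : finType) (e : rel T) (m : nat) (v : T)
    (A : {set T}) :
  simple_graph e -> induced_free (@biclique 1 m.+1) e ->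
  A \subset out_nbr e v -> {in A &, forall x y, ~~ e x y} -> #|A| != m.+1.
Proof.
move=> [symE irrE] freeE /subsetP sAv indA; apply/eqP => cardA.
have adj x : x \in A -> e v x by move/sAv; rewrite inE.
have vA : v \notin A by apply/negP => /adj; rewrite irrE.
(* The centre goes to the one-point side, each leaf to its position in [enum A]. These positions lie
   below [#|A| = m.+1], so [inord] never takes its default value. *)
pose phi (x : {x | x \in v |: A}) : 'I_1 + 'I_m.+1 :=
  if val x == v then inl ord0 else inr (inord (index (val x) (enum A))).
have inA (x : {x | x \in v |: A}) : val x != v -> val x \in A.
  by move=> xv; have := valP x; rewrite in_setU1 (negbTE xv).
apply: (freeE (v |: A)); exists phi.
  (* Both sides have [m.+2] elements, so injectivity is enough. *)
  apply: inj_card_bij => [x y|]; last first.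
    by rewrite card_sum !card_ord card_sig cardsU1 vA cardA.
  rewrite /phi; case: (eqVneq (val x) v) => xv; case: (eqVneq (val y) v) => yv //.
    by move=> _; apply: val_inj; rewrite /= xv yv.
  have ltA z : z \in A -> index z (enum A) < m.+1.
    by rewrite -mem_enum -index_mem -cardE cardA.
  case=> /(congr1 val); rewrite /= !inordK ?ltA ?inA // => eq_xy.
  apply: val_inj; apply: (@index_inj _ v (enum A)) eq_xy;
  by rewrite mem_enum inA.
move=> x y; rewrite /phi /biclique /induced /=.
case: (eqVneq (val x) v) => xv; case: (eqVneq (val y) v) => yv /=.
- by rewrite xv yv irrE.
- by rewrite xv adj ?inA.
- by rewrite yv symE adj ?inA.
- by rewrite (negbTE (indA _ _ _ _)) ?inA.
Qed.

Lemma card_setC2 (n : nat) (i j : 'I_n.+2) : i != j -> #|~: [set i; j]| = n.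
Proof. by move=> ij; rewrite cardsCs setCK cards2 ij card_ord subn2. Qed.

Definition tail (p : nat) (u : Lvertex p) : 'Z_p.+2 := (val u).1.
Definition head (p : nat) (u : Lvertex p) : 'Z_p.+2 := (val u).2.

Lemma tail_neq_head (p : nat) (u : Lvertex p) : tail u != head u.
Proof. exact: (valP u). Qed.

Lemma Lvertex_eq (p : nat) (u w : Lvertex p) :
  tail u = tail w -> head u = head w -> u = w.
Proof.
rewrite /tail /head => eq1 eq2; apply: val_inj.
by rewrite [LHS]surjective_pairing eq1 eq2 -surjective_pairing.
Qed.

Lemma Lvertex_exists (p : nat) (i j : 'Z_p.+2) :
  i != j -> exists w : Lvertex p, tail w = i /\ head w = j.
Proof.
by move=> ij; exists (exist (fun x : 'Z_p.+2 * 'Z_p.+2 => x.1 != x.2) (i, j) ij).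
Qed.

Lemma LarcE (p : nat) (u w : Lvertex p) :
  Larc u w = (head u == tail w) && (head w != tail u).
Proof. by []. Qed.

(** An out-neighbour (j,k) of (i,j) is determined by its head k, which ranges over everything except
    i and j. *)
Lemma card_out_Larc (p : nat) (u : Lvertex p) : #|out_nbr (@Larc p) u| = p.
Proof.
rewrite -[RHS](card_setC2 (tail_neq_head u)).
rewrite -(card_in_imset (f := @head p)); last first.
  move=> x y; rewrite !inE !LarcE => /andP[/eqP x1 _] /andP[/eqP y1 _].
  by apply: Lvertex_eq; rewrite -x1.
apply: eq_card => k; rewrite !inE negb_or.
apply/imsetP/andP => [[w]|[k1 k2]].
  rewrite inE LarcE => /andP[/eqP w1 w2] ->; split=> //.
  by rewrite w1 eq_sym tail_neq_head.
have jk : head u != k by rewrite eq_sym.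
have [w [w1 w2]] := Lvertex_exists jk.
by exists w; rewrite ?inE ?LarcE w2 // w1 eqxx.
Qed.

Lemma card_in_Larc (p : nat) (u : Lvertex p) : #|in_nbr (@Larc p) u| = p.
Proof.
rewrite -[RHS](card_setC2 (tail_neq_head u)).
rewrite -(card_in_imset (f := @tail p)); last first.
  move=> x y; rewrite !inE !LarcE => /andP[/eqP x2 _] /andP[/eqP y2 _] xy.
  by apply: Lvertex_eq; rewrite ?x2.
apply: eq_card => k; rewrite !inE negb_or.
apply/imsetP/andP => [[w]|[k1 k2]].
  rewrite inE LarcE => /andP[/eqP w2 w1] ->; split; last by rewrite eq_sym.
  by rewrite -w2 tail_neq_head.
have [w [w1 w2]] := Lvertex_exists k1.
by exists w; rewrite ?inE ?LarcE w1 // w2 eqxx eq_sym.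
Qed.

(** Disjoint targets rule out collisions between [A] and [B]. This glues the bijections on in- and
    out-neighbours into one on undirected neighbourhoods. *)
Lemma maps_bijU (T U : finType) (f : T -> U) (A B : {set T}) (C D : {set U}) :
  [disjoint C & D] -> maps_bij f A C -> maps_bij f B D ->
  maps_bij f (A :|: B) (C :|: D).
Proof.
move=> CD [injA fA] [injB fB]; split; last by rewrite imsetU fA fB.
have disj x y : x \in A -> y \in B -> f x <> f y.
  move=> xA yB fxy; have /(disjointFr CD) : f x \in C by rewrite -fA imset_f.
  by rewrite fxy -fB imset_f.
move=> x y /setUP[xA|xB] /setUP[yA|yB] fxy.
- exact: injA.
- by case: (disj x y).
- by case: (disj y x).
- exact: injB.
Qed.

Lemma out_nbr_underlying (T : finType) (a : rel T) (v : T) :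
  out_nbr (underlying a) v = out_nbr a v :|: in_nbr a v.
Proof. by apply/setP => w; rewrite !inE. Qed.

Lemma disjoint_out_in_nbr (T : finType) (a : rel T) (v : T) :
  oriented_graph a -> [disjoint out_nbr a v & in_nbr a v].
Proof.
move=> oa; rewrite -setI_eq0; apply/eqP/setP => w; rewrite !inE.
by apply/negP => /andP[/oa /negP].
Qed.

(** The inequality required by an arc from [x] to [y] negates the equality required by an arc from
    [y] to [x]. *)
Lemma oriented_Larc (p : nat) : oriented_graph (@Larc p).
Proof. by move=> x y /= /andP[_ ne]; rewrite negb_and ne. Qed.

Section InNeighbourhoods.

Variables (p : nat) (T : finType) (G Gv : rel T) (psi : T -> Lvertex p).
Hypotheses (hG : simple_graph G) (hfree : induced_free (@biclique 1 p.+1) G).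
Hypotheses (hreg : regular (2 * p) G) (hGv : orientation_of G Gv).
Hypothesis hpsi : out_nbr_bij_hom Gv (@Larc p) psi.

Lemma out_nbr_orientation v : out_nbr G v = out_nbr Gv v :|: in_nbr Gv v.
Proof.
by rewrite -out_nbr_underlying; apply/setP => w; rewrite !inE -hGv.2.
Qed.

Lemma psi_arc x y : Gv x y -> Larc (psi x) (psi y).
Proof.
by move=> xy; have := imset_f psi (_ : y \in out_nbr Gv x);
  rewrite (hpsi x).2 !inE => ->.
Qed.

(** The bijection [psi] forces out-degree [p], which leaves [p] of the [2 * p] neighbours as
    in-neighbours. *)
Lemma card_in_nbr v : #|in_nbr Gv v| = p.
Proof.
have cardO : #|out_nbr Gv v| = p.
  by rewrite -(card_in_imset (hpsi v).1) (hpsi v).2 card_out_Larc.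
have := hreg v; rewrite out_nbr_orientation cardsU.
have := disjoint_out_in_nbr v hGv.1; rewrite -setI_eq0 => /eqP ->.
by rewrite cards0 subn0 cardO mul2n -addnn => /addnI.
Qed.

Lemma psi_in_nbr v : psi @: in_nbr Gv v = in_nbr (@Larc p) (psi v).
Proof.
apply/eqP; rewrite eqEsubset; apply/andP; split.
  by apply/subsetP => _ /imsetP[u + ->]; rewrite !inE; exact: psi_arc.
apply/subsetP => x xin; apply/negPn/negP => xnot.
have /andP[/eqP x2 x1] : (head x == tail (psi v)) && (head (psi v) != tail x).
  by rewrite -LarcE; rewrite inE in xin.
(* With [psi v] = (i,j) and the missed vertex [x] = (k,i), take [y] = (j,k). It is an out-neighbour
   of [psi v] because k differs from i, so it lifts to an out-neighbour [w] of [v]. *)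
have [y [y1 y2]] := Lvertex_exists x1.
have : y \in psi @: out_nbr Gv v.
  by rewrite (hpsi v).2 inE LarcE y1 y2 eqxx -x2 tail_neq_head.
case/imsetP => w; rewrite inE => vw psiw.
rewrite {y}psiw in y1 y2.
have inP u : u \in in_nbr Gv v -> head (psi u) = tail (psi v).
  by rewrite inE => /psi_arc; rewrite LarcE => /andP[/eqP].
have no_arc : {in w |: in_nbr Gv v &, forall y z, ~~ Gv y z}.
  move=> y z yA zA; apply/negP => yz.
  have /eqP eq_yz : head (psi y) == tail (psi z).
    by have := psi_arc yz; rewrite LarcE => /andP[].
  (* An arc from [w] to an in-neighbour [z] would give [psi z] = (k,i) = [x], which is missed. An
     arc from an in-neighbour to [w] would force i = j, and one between two in-neighbours would make
     [psi z] = (i,i). *)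
  case/setU1P: yA => [yw|/inP yv]; case/setU1P: zA => [zw|zin].
  - by have := hGv.1 _ _ yz; move: yz; rewrite yw zw => ->.
  - case/negP: xnot; apply/imsetP; exists z => //.
    by apply: Lvertex_eq; rewrite -?eq_yz ?yw // x2 inP.
  - by have := tail_neq_head (psi v); rewrite -y1 -zw -eq_yz yv eqxx.
  - by have := tail_neq_head (psi z); rewrite inP // -eq_yz yv eqxx.
have wnot : w \notin in_nbr Gv v by rewrite inE; exact: hGv.1.
have /eqP[] : #|w |: in_nbr Gv v| != p.+1.
  apply: (@star_free_card_independent _ _ p v) hG hfree _ _.
    by rewrite out_nbr_orientation setSU // sub1set inE.
  by move=> y z yA zA; rewrite -hGv.2 /= negb_or !no_arc.
by rewrite cardsU1 wnot card_in_nbr.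
Qed.

Lemma maps_bij_in_nbr v :
  maps_bij psi (in_nbr Gv v) (in_nbr (@Larc p) (psi v)).
Proof.
split; last exact: psi_in_nbr.
by apply/imset_injP; rewrite psi_in_nbr card_in_Larc card_in_nbr.
Qed.

End InNeighbourhoods.

Theorem theorem12 (p : nat) (hp : 2 <= p)
  (T : finType) (G : rel T)
  (hG : simple_graph G)
  (hfree : induced_free (@biclique 1 p.+1) G)
  (hreg : regular (2 * p) G)
  (Gv : rel T) (hGv : orientation_of G Gv)
  (psi : T -> Lvertex p)
  (hpsi : out_nbr_bij_hom Gv (@Larc p) psi) :
  loc_bij_hom_oriented Gv (@Larc p) psi /\ loc_bij_hom G (@Lstar p) psi.
Proof.
have psi_in := maps_bij_in_nbr hG hfree hreg hGv hpsi.
split=> v; first by split; [exact: psi_in | exact: hpsi].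
(* Undirected neighbourhoods on both sides split into out- and in-parts, on each of which [psi] is
   already bijective. *)
rewrite (out_nbr_orientation hGv) out_nbr_underlying.
by apply: maps_bijU => //; apply: disjoint_out_in_nbr; exact: oriented_Larc.
Qed.
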